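(* Let $n\ge 3$ and let $p\in\{2,3,\dots,n-1\}$. Let $t=2^{p-1}$, let $(c_1,\dots,c_t)=cc(p)$ be the control sequence defined in the context, and let $\phi_1,\dots,\phi_{t-1}$ be arbitrary real angles. Consider the $n$-qubit subcircuit $$S_p=\mathrm{CNOT}(c_1,p)\circ R_Z(-\phi_1;p)\circ\mathrm{CNOT}(c_2,p)\circ R_Z(-\phi_2;p)\circ\cdots\circ R_Z(-\phi_{t-1};p)\circ\mathrm{CNOT}(c_t,p),$$ that is, an alternating sequence of $2^{p-1}$ CNOT gates with controls given by $cc(p)$ and target $p$, and $2^{p-1}-1$ $R_Z$ gates acting on qubit $p$. Then $S_p$ commutes with the gate $\mathrm{CNOT}(p,n)$; that is, $S_p\circ\mathrm{CNOT}(p,n)$ and $\mathrm{CNOT}(p,n)\circ S_p$ implement the same unitary.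
   Context: Qubits are numbered $1,\dots,n$. $\mathrm{CNOT}(c,t)$ has control $c$ and target $t$: $|k_c\rangle|k_t\rangle\mapsto|k_c\rangle|k_t\oplus k_c\rangle$ on computational basis states. $R_Z(-\phi;r)$ acts on qubit $r$ by $|k_r\rangle\mapsto e^{i\phi(-1)^{k_r}/2}|k_r\rangle$. The symbol $\circ$ denotes concatenation of (sub)circuits, the leftmost being applied first. CNOT controls: $cc(2)=(1,1)$; for $p\ge 3$, $cc(p)$ has length $2^{p-1}$ and is the concatenation of two copies of the sequence obtained from $cc(p-1)$ by replacing its last (i.e. $2^{p-2}$-th) element by $p-1$. (E.g. $cc(3)=(1,2,1,2)$, $cc(4)=(1,2,1,3,1,2,1,3)$.) *)

(* Defs.v *)
From mathcomp Require Import all_boot all_order all_algebra.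
From mathcomp Require Import complex.
From mathcomp Require Import reals trigo.
Set Implicit Arguments.
Unset Strict Implicit.
Unset Printing Implicit Defensive.
Import Order.TTheory GRing.Theory Num.Theory.
Local Open Scope ring_scope.
Local Open Scope complex_scope.

(* Qubits carry the labels 1, ..., n, as natural numbers.  A computational basis
   state is a function 'I_n -> bool; the ordinal of value j holds qubit j.+1. *)
Notation basis n := {ffun 'I_n -> bool}.

(* k_r; a label outside 1, ..., n reads as false. *)
Definition bit n (k : basis n) (r : nat) : bool :=
  [exists j : 'I_n, (j.+1 == r) && k j].

Definition cnot_basis n (c t : nat) (k : basis n) : basis n :=
  [ffun j : 'I_n => if j.+1 == t then k j (+) bit k c else k j].

Lemma bitE n (k : basis n) (j : 'I_n) : bit k j.+1 = k j.
Proof.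
apply/existsP/idP => [[i /andP[/eqP[/val_inj ->]]]//|kj].
by exists j; rewrite eqxx.
Qed.

Inductive gate (R : Type) : Type :=
  | CNOT of nat & nat  (* control, target *)
  | RZ of R & nat.     (* angle, qubit *)
Arguments CNOT {R} c t.
Arguments RZ {R} theta r.

(* The head of the sequence is the gate applied first, so that the concatenation
   of circuits is ++. *)
Notation circuit R := (seq (gate R)).

Definition wf_gate R n (g : gate R) : bool :=
  match g with
  | CNOT c t => [&& (0 < c <= n)%N, (0 < t <= n)%N & c != t]
  | RZ _ r => (0 < r <= n)%N
  end.

Definition expi (R : realType) (x : R) : R[i] := cos x +i* sin x.

(* States of n qubits are column vectors of length 2 ^ n = #|basis n|. *)
Definition ket (R : realType) n (k : basis n) : 'cV[R[i]]_#|basis n| :=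
  delta_mx (enum_rank k) 0.

(* RZ theta r maps |k> to e^(- i theta (-1)^(k_r) / 2) |k>. *)
Definition gate_ket (R : realType) n (g : gate R) (k : basis n) :
    'cV[R[i]]_#|basis n| :=
  match g with
  | CNOT c t => ket R (cnot_basis c t k)
  | RZ theta r => expi (- theta * (-1) ^+ bit k r / 2) *: ket R k
  end.

Definition gate_mx (R : realType) n (g : gate R) : 'M[R[i]]_#|basis n| :=
  \matrix_(i, j) gate_ket g (enum_val j) i 0.

Fixpoint circuit_mx (R : realType) n (C : circuit R) : 'M[R[i]]_#|basis n| :=
  if C is g :: C' then circuit_mx n C' *m gate_mx n g else 1%:M.

(* cc p is meaningful for p >= 2. *)
Fixpoint cc (p : nat) : seq nat :=
  match p with
  | 0 | 1 => [::]
  | 2 => [:: 1; 1]%N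
  | p'.+1 => let s := set_nth 0%N (cc p') (size (cc p')).-1 p' in s ++ s
  end.

(* The angles phi_1, phi_2, ... are a function on nat, of which only the values
   at 1, ..., 2 ^ (p - 1) - 1 are used. *)
Definition subcircuit (R : realType) (p : nat) (phi : nat -> R) : circuit R :=
  let t := (2 ^ p.-1)%N in
  let c j := nth 0%N (cc p) j.-1 in
  flatten [seq [:: CNOT (c j) p; RZ (- phi j) p] | j <- index_iota 1 t]
    ++ [:: CNOT (c t) p].

Example cc3 : cc 3 = [:: 1; 2; 1; 2]%N. Proof. by []. Qed.

Example cc4 : cc 4 = [:: 1; 2; 1; 3; 1; 2; 1; 3]%N. Proof. by []. Qed.

Lemma ccSS p : cc p.+3 =
  set_nth 0%N (cc p.+2) (size (cc p.+2)).-1 p.+2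
  ++ set_nth 0%N (cc p.+2) (size (cc p.+2)).-1 p.+2.
Proof. by []. Qed.

Lemma size_cc p : size (cc p.+2) = (2 ^ p.+1)%N.
Proof.
elim: p => [|p IHp]//; rewrite ccSS size_cat size_set_nth IHp.
rewrite prednK ?expn_gt0//.
by rewrite maxnn addnn -mul2n (expnS 2 p.+1).
Qed.

Lemma cc_bounds p c : c \in cc p.+2 -> (0 < c < p.+2)%N.
Proof.
elim: p c => [|p IHp] c; first by rewrite !inE => /orP[]/eqP->.
rewrite ccSS mem_cat orbb => /(nthP 0%N)[j].
rewrite size_set_nth size_cc prednK ?expn_gt0// maxnn => ltj <-.
rewrite nth_set_nth /=; case: eqP => [_|_]; first by rewrite ltnSn.
have /IHp/andP[-> /leqW] // : nth 0%N (cc p.+2) j \in cc p.+2.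
by apply: mem_nth; rewrite size_cc.
Qed.

Lemma subcircuit_wf (R : realType) n p (phi : nat -> R) :
  (2 <= p <= n.-1)%N -> all (wf_gate n) (CNOT p n :: subcircuit p phi).
Proof.
case: p => [|[|p]]// /andP[_ pn].
have ltpn : (p.+2 < n)%N by case: n pn.
have cP j : (0 < j <= 2 ^ p.+1)%N -> wf_gate n (@CNOT R (nth 0%N (cc p.+2) j.-1) p.+2).
  case: j => // j /= ltj; have /cc_bounds/andP[c0 cp] : nth 0%N (cc p.+2) j \in cc p.+2.
    by apply: mem_nth; rewrite size_cc.
  by rewrite c0 (ltnW (ltn_trans cp ltpn)) (ltnW ltpn) /= neq_ltn cp.
rewrite /= [in (0 < n)%N](leq_trans _ ltpn)// leqnn (ltnW ltpn) neq_ltn ltpn /=.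
rewrite /subcircuit all_cat /= andbT; apply/andP; split; last first.
  by apply: (cP (2 ^ p.+1)%N); rewrite expn_gt0 leqnn.
have : {in index_iota 1 (2 ^ p.+1), forall j, (0 < j <= 2 ^ p.+1)%N}.
  by move=> j; rewrite mem_index_iota => /andP[-> /ltnW].
elim: (index_iota _ _) => //= j s IHs js; apply/and3P; split.
- exact/cP/js/mem_head.
- exact: ltnW.
- by apply: IHs => l ls; apply: js; rewrite inE ls orbT.
Qed.

Lemma gate_mx_ket (R : realType) n (g : gate R) (k : basis n) :
  gate_mx n g *m ket R k = gate_ket g k.
Proof. by rewrite -colE; apply/colP => i; rewrite !mxE enum_rankK. Qed.

Lemma circuit_mx_cat (R : realType) n (C D : circuit R) :
  circuit_mx n (C ++ D) = circuit_mx n D *m circuit_mx n C.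
Proof. by elim: C => [|g C IHC] /=; rewrite ?mulmx1// IHC mulmxA. Qed.

Lemma cnot_basisK n c t : c != t -> involutive (@cnot_basis n c t).
Proof.
move=> ct k; apply/ffunP => j; rewrite !ffunE.
have -> : bit (cnot_basis c t k) c = bit k c.
  apply: eq_existsb => i; rewrite ffunE.
  by case: (eqVneq i.+1 c) => // ->; rewrite (negPf ct).
by case: eqP => //; rewrite -addbA addbb addbF.
Qed.

Lemma expi_conj (R : realType) (x : R) : (expi x)^* * expi x = 1.
Proof.
by rewrite /expi; simpc; rewrite -!expr2 cos2Dsin2 [sin x * _]mulrC subrr.
Qed.

Lemma gate_mx_unitary (R : realType) n (g : gate R) :
  wf_gate n g -> gate_mx n g \is unitarymx.
Proof.
move=> wg; have [a [f [f_inj aK gE]]] : exists a : basis n -> R[i],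
    exists f : basis n -> basis n, [/\ injective f,
      forall k, Num.conj (a k) * a k = 1 &
      forall k, gate_ket g k = a k *: ket R (f k)].
  case: g wg => [c t /and3P[_ _ ct]|theta r _].
    exists (fun=> 1), (cnot_basis c t); split=> [|k|k].
    - exact: inv_inj (cnot_basisK ct).
    - by rewrite rmorph1 mulr1.
    - by rewrite scale1r.
  exists (fun k => expi (- theta * (-1) ^+ bit k r / 2)), id.
  by split=> // k; apply: expi_conj.
rewrite -trmxC_unitary; apply/unitarymxP; rewrite trmxCK.
apply/matrixP => i j; rewrite !mxE.
rewrite (bigD1 (enum_rank (f (enum_val j)))) //= big1 ?addr0 => [|k kj].
  rewrite !mxE !gE !mxE !eqxx mulr1 !andbT.
  rewrite (inj_eq enum_rank_inj) (inj_eq f_inj) (inj_eq enum_val_inj) eq_sym.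
  by case: (eqVneq i j) => [->|_]; rewrite ?mulr1 ?aK// mulr0 rmorph0 mul0r.
by rewrite !mxE !gE !mxE (negPf kj) !mulr0.
Qed.

(* Main.v *)
Require Import Defs.
From mathcomp Require Import all_boot all_order all_algebra.
From mathcomp Require Import complex.
From mathcomp Require Import reals trigo.

(** A circuit whose gates all act on qubit p, with controls other than p, maps
    |k> to a multiple of the basis state obtained by adding to k_p the sum of
    the bits of k at the controls. The sequence cc p is a square s ++ s, so this
    sum vanishes and S_p is diagonal. Its coefficient at |k> only involves the
    qubits 1, ..., p, hence is invariant under flipping k_n. *)

Set Implicit Arguments.
Unset Strict Implicit.
Unset Printing Implicit Defensive.
Import GRing.Theory.
Local Open Scope ring_scope.

(** A CNOT is such a flip with [b] read off the state. With [b] kept as a separate argument, flips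
    of one qubit compose by adding their bits, and all flips commute. *)
Definition xor_bit n (r : nat) (b : bool) (k : basis n) : basis n :=
  [ffun j : 'I_n => if j.+1 == r then k j (+) b else k j].

Lemma cnot_basisE n c t (k : basis n) :
  cnot_basis c t k = xor_bit t (bit k c) k.
Proof. by []. Qed.

Lemma bit_xor_bit n r s b (k : basis n) :
  s != r -> bit (xor_bit r b k) s = bit k s.
Proof.
move=> sr; apply: eq_existsb => j; rewrite ffunE.
by case: (eqVneq j.+1 s) => // ->; rewrite (negPf sr).
Qed.

Lemma xor_bit0 n r (k : basis n) : xor_bit r false k = k.
Proof. by apply/ffunP => j; rewrite ffunE addbF if_same. Qed.

Lemma xor_bitD n r b c (k : basis n) :
  xor_bit r b (xor_bit r c k) = xor_bit r (c (+) b) k.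
Proof. by apply/ffunP => j; rewrite !ffunE; case: eqP => // _; rewrite addbA. Qed.

Lemma xor_bitC n r s b c (k : basis n) :
  xor_bit r b (xor_bit s c k) = xor_bit s c (xor_bit r b k).
Proof.
by apply/ffunP => j; rewrite !ffunE; do 2!case: eqP => // _; rewrite addbAC.
Qed.

Lemma eq_mx_ket (R : realType) n (A B : 'M[R[i]]_#|basis n|) :
  (forall k : basis n, A *m ket R k = B *m ket R k) -> A = B.
Proof.
move=> AB; apply/matrixP => i j.
have /colP/(_ i) := AB (enum_val j).
by rewrite /ket enum_valK -!colE !mxE.
Qed.

Definition target (R : Type) (g : gate R) : nat :=
  match g with CNOT _ t => t | RZ _ r => r end.

Definition controls (R : Type) (C : circuit R) : seq nat :=
  pmap (fun g => if g is CNOT c _ then Some c else None) C.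

Definition parity n (s : seq nat) (k : basis n) : bool :=
  \big[addb/false]_(c <- s) bit k c.

Lemma parity_xor_bit n s r b (k : basis n) :
  r \notin s -> parity s (xor_bit r b k) = parity s k.
Proof.
move=> rs; apply: eq_big_seq => c cs; rewrite bit_xor_bit//.
by apply: contraNneq rs => <-.
Qed.

(** Since [p] is never a control, no gate changes a control bit, so every control can be read on the
    initial state. The phases only read qubit [p], whose value depends on [p] and the controls,
    never on [q]. *)
Lemma circuit_mx_target (R : realType) n p q (C : circuit R) :
    p != q -> all (fun g => target g == p) C ->
    p \notin controls C -> q \notin controls C ->
  exists2 a : basis n -> R[i],
    forall b k, a (xor_bit q b k) = a k &
    forall k, circuit_mx n C *m ket R k
              = a k *: ket R (xor_bit p (parity (controls C) k) k).
Proof.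
move=> pq; elim: C => [_ _ _|g C IHC /= /andP[/eqP gp Cp]].
  exists (fun=> 1) => // k.
  by rewrite mul1mx scale1r /parity big_nil xor_bit0.
case: g gp => [c t|theta r] /= ->; rewrite ?inE ?negb_or.
  move=> /andP[pc pC] /andP[qc qC]; have [a aq aC] := IHC Cp pC qC.
  (* The head gate acts first and adds no phase, so the coefficient is that of the tail at the
     flipped state. *)
  exists (fun k => a (cnot_basis c p k)) => [b k|k].
    by rewrite !cnot_basisE bit_xor_bit 1?eq_sym// xor_bitC aq.
  rewrite -mulmxA gate_mx_ket /= aC cnot_basisE parity_xor_bit// xor_bitD.
  by rewrite /parity big_cons.
move=> pC qC; have [a aq aC] := IHC Cp pC qC.
exists (fun k => expi (- theta * (-1) ^+ bit k p / 2) * a k) => [b k|k].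
  by rewrite bit_xor_bit// aq.
by rewrite -mulmxA gate_mx_ket /= -scalemxAr aC scalerA.
Qed.

Lemma cc_square p : exists s, cc p.+2 = s ++ s.
Proof. by case: p => [|p]; [exists [:: 1%N] | eexists; exact: ccSS]. Qed.

Lemma parity_cc n p (k : basis n) : parity (cc p.+2) k = false.
Proof. by have [s ->] := cc_square p; rewrite /parity big_cat /= addbb. Qed.

Lemma controls_subcircuit (R : realType) p (phi : nat -> R) :
  controls (subcircuit p.+2 phi) = cc p.+2.
Proof.
rewrite /subcircuit [p.+2.-1]/=; set t := (2 ^ p.+1)%N.
have t0 : (0 < t)%N by rewrite expn_gt0.
rewrite /controls pmap_cat /=.
(* [index_iota 1 t] stops at [t - 1]; the closing CNOT supplies the index [t]. *)
transitivity [seq nth 0%N (cc p.+2) j.-1 | j <- rcons (index_iota 1 t) t].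
  by rewrite map_rcons -cats1; congr (_ ++ _); elim: index_iota => //= j s ->.
rewrite -[RHS](mkseq_nth 0%N) size_cc -/t /mkseq.
(* The indices 1, ..., t are the successors of 0, ..., t - 1, which cancels the [.-1] in the
   lookup. *)
have -> : rcons (index_iota 1 t) t = map succn (iota 0 t).
  case: (t) t0 => // m _; rewrite -cats1 /index_iota subn1.
  by rewrite -[RHS](iotaDl 1 0) -[m.+1 in RHS]addn1 iotaD.
by rewrite -map_comp.
Qed.

Lemma target_subcircuit (R : realType) p (phi : nat -> R) :
  all (fun g => target g == p) (subcircuit p phi).
Proof.
rewrite /subcircuit all_cat /= eqxx !andbT.
by elim: index_iota => //= j s ->; rewrite eqxx.
Qed.

Theorem theorem2 (R : realType) (n p : nat) (phi : nat -> R) :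
  (3 <= n)%N -> (2 <= p <= n.-1)%N ->
  circuit_mx n (subcircuit p phi ++ [:: CNOT p n]) =
  circuit_mx n (CNOT p n :: subcircuit p phi).
Proof.
case: p => [|[|p]]// n3 /andP[_ pn].
have ltpn : (p.+2 < n)%N by case: n n3 pn.
(* All controls lie strictly below [p.+2], which excludes both the target and [n]. *)
have notin_cc r : (p.+2 <= r)%N -> r \notin cc p.+2.
  by move=> pr; apply/negP => /cc_bounds/andP[_]; rewrite ltnNge pr.
have [||||a an aC] := @circuit_mx_target R n p.+2 n (subcircuit p.+2 phi).
- by rewrite neq_ltn ltpn.
- exact: target_subcircuit.
- by rewrite controls_subcircuit notin_cc.
- by rewrite controls_subcircuit notin_cc// ltnW.
have diagS k : circuit_mx n (subcircuit p.+2 phi) *m ket R k = a k *: ket R k.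
  by rewrite aC controls_subcircuit parity_cc xor_bit0.
rewrite circuit_mx_cat [circuit_mx n [:: _]]/= mul1mx [circuit_mx n (_ :: _)]/=.
(* Both sides give the ket of [cnot_basis p.+2 n k], with coefficient [a] taken before or after the
   flip of qubit [n]. *)
apply: eq_mx_ket => k; rewrite -!mulmxA diagS -scalemxAr gate_mx_ket /= diagS.
by rewrite cnot_basisE an.
Qed.
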